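(* Consider Ultimate Tic-Tac-Toe and let Xavier (the first player) follow the three-phase strategy $\mathcal{S}$ described in the context, against arbitrary legal play by Olivia. Then, from the beginning of the endgame phase on, the properties P1--P6 (see context) hold every time it is Olivia's turn, as long as Xavier has not won the game. Consequently, Xavier eventually wins the game in every play in which he follows $\mathcal{S}$.
   Context: **Game.** Ultimate Tic-Tac-Toe is played on a board of 9 fields arranged in a $3\times3$ grid, indexed row by row from the top left: $0,1,2$ / $3,4,5$ / $6,7,8$. Each field consists of 9 spots arranged in a $3\times 3$ grid and indexed in the same way; $(i,j)$ denotes spot $j$ of field $i$. The lines of a $3\times3$ grid are its three rows, three columns and two diagonals. Xavier (marks X) moves first, then Olivia (marks O) and Xavier alternate; a move places one mark in a free spot of the active field. If the previous move was $(i,j)$ and field $j$ has a free spot, the active field is $j$ (whether or not field $j$ has already been won). If the previous move was $(i,j)$ and field $j$ has no free spot, or if there is no previous move, the player to move freely chooses as active field any field with a free spot. A player wins a field when they are the first to have three of their marks on a line of that field; once won, the status of a field never changes, though its free spots can still be played. A player wins the game when they have won three fields forming a line of the board, and the game then ends. If the board is filled with no winner the game is a draw. **Strategy $\mathcal{S}$ for Xavier.** - *Opening.* Xavier's first move is $(4,4)$. For each of his next seven moves, if Olivia has just played $(4,j)$, Xavier plays $(j,4)$. After Olivia's eighth move field 4 is full. Let $(4,f)$ be that eighth move; field $f$ is the only field in which nobody has played. Put $f'=8-f$ (the field opposite to $f$ with respect to the centre) and $A=\{0,\dots,8\}\setminus\{4,f,f'\}$. - *Middlegame.* Xavier plays $(f,f)$.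 Then, each time Olivia plays $(f,k)$: if $k\in A$, Xavier plays $(k,f)$; if $k\in\{4,f'\}$, Xavier plays $(f',f)$ if he has not already played it, and otherwise he plays $(f',f')$, at which point the middlegame is over. - *Endgame.* It begins right after Xavier's move $(f',f')$, with Olivia to move. Whenever it is Xavier's turn with active field $k$, he plays $(k,f)$ if that spot is free, and otherwise $(k,f')$. **Properties** (evaluated at a position of the endgame phase where Olivia is to move; ''Olivia plays in field $x$'' means that the active field for her upcoming move is $x$; ''$i$ verifies P5'' means that $i\in A$, $(f',i)$ is taken by Olivia, and $(f,i)$ is not taken by Olivia). - P1: for all $i\in A$, if $(i,f)$ and $(i,f')$ are both taken by Xavier, then $(f,i)$ and $(f',i)$ are both taken by Olivia. - P2: for all $i\in A$, if exactly one of $(i,f),(i,f')$ is taken by Xavier, then it is $(i,f)$, exactly one of $(f,i),(f',i)$ is taken by Olivia, and if the latter is $(f',i)$ then Olivia plays in field $f$. - P3: for all $i\in A$, if neither $(i,f)$ nor $(i,f')$ is taken by Xavier, then neither $(f,i)$ nor $(f',i)$ is taken by Olivia. - P4: Olivia must play in field $f$ or in field $f'$, and the field in which she plays is not full (in particular $f$ and $f'$ are not both full). - P5: Olivia plays in field $f$ if and only if there is a unique $i$ that verifies P5; and Olivia plays in field $f'$ if and only if no $i$ verifies P5. - P6: Olivia has only played in fields $f,4,f'$, and Xavier has not played in $(f,i)$ or $(f',i)$ for any $i\in A$. *)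

(* Defs.v *)
From mathcomp Require Import all_boot.

Set Implicit Arguments.
Unset Strict Implicit.
Unset Printing Implicit Defensive.

(** * The game *)

(* The cells of a 3x3 grid, numbered row by row from the top left; used both
   for the fields of the board and for the spots of a field.  [(i, j)] is spot
   [j] of field [i]. *)
Notation cell := 'I_9.
Notation move := (cell * cell)%type.
Notation "# k" := (@Ordinal 9 k isT) (at level 0, k at level 0, format "# k").

Definition lines : seq (seq cell) :=
  [:: [:: #0; #1; #2]; [:: #3; #4; #5]; [:: #6; #7; #8];
      [:: #0; #3; #6]; [:: #1; #4; #7]; [:: #2; #5; #8];
      [:: #0; #4; #8]; [:: #2; #4; #6]].

Definition has_line (P : pred cell) : bool := has (all P) lines.

Definition player := bool.
Definition Xavier : player := true.
Definition Olivia : player := false.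

(* [status p i] is the player who has won field [i], if any. *)
Record position := Position {
  mark : move -> option player;
  status : cell -> option player;
  last_move : option move;
  turn : player
}.

Definition start : position :=
  Position (fun=> None) (fun=> None) None Xavier.

Definition full (p : position) (i : cell) : bool :=
  [forall j, mark p (i, j) != None].

Definition open_fields (p : position) : {set cell} := [set i | ~~ full p i].

(* The fields that may be the active field of the next move: a singleton when
   the last move imposes it, all the fields with a free spot otherwise. *)
Definition active (p : position) : {set cell} :=
  if last_move p is Some (_, j) then
    if full p j then open_fields p else [set j]
  else open_fields p.

Definition has_won (w : player) (p : position) : bool :=
  has_line (fun i => status p i == Some w).

(* No move is legal once the game is won, nor when the board is full, since
   then no spot is free. *)
Definition legal (p : position) (m : move) : bool :=
  [&& ~~ has_won Xavier p, ~~ has_won Olivia p,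
      m.1 \in active p & mark p m == None].

Definition play_move (p : position) (m : move) : position :=
  let mark' := [eta mark p with m |-> Some (turn p)] in
  let status' i :=
    if [&& i == m.1, status p i == None
         & has_line (fun j => mark' (i, j) == Some (turn p))]
    then Some (turn p) else status p i in
  Position mark' status' (Some m) (~~ turn p).

(** * Xavier's strategy *)

(* [opp f] is the cell [8 - f]. *)
Definition opp (f : cell) : cell := rev_ord f.

Definition A (f : cell) : {set cell} := ~: [set #4; f; opp f].

(* [Opening n]: Xavier has made [n] moves, all in the opening.
   [Middlegame f] and [Endgame f] record the field [f] in which nobody played
   during the opening. *)
Inductive phase :=
  | Opening of nat
  | Middlegame of cell
  | Endgame of cell.

(* [prescribes p ph m ph']: with Xavier to move in position [p] and phase [ph],
   the strategy allows the move [m], and [ph'] is the phase right after [m].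
   Legality of [m] is not part of this relation. *)
Inductive prescribes (p : position) : phase -> move -> phase -> Prop :=
  | Prescribes_first :
      prescribes p (Opening 0) (#4, #4) (Opening 1)
  | Prescribes_opening n j :
      0 < n < 8 -> last_move p = Some (#4, j) ->
      prescribes p (Opening n) (j, #4) (Opening n.+1)
  | Prescribes_middlegame_start f :
      last_move p = Some (#4, f) ->
      prescribes p (Opening 8) (f, f) (Middlegame f)
  | Prescribes_middlegame_A f k :
      last_move p = Some (f, k) -> k \in A f ->
      prescribes p (Middlegame f) (k, f) (Middlegame f)
  | Prescribes_middlegame_once f k :
      last_move p = Some (f, k) -> k \in [set #4; opp f] ->
      mark p (opp f, f) <> Some Xavier ->
      prescribes p (Middlegame f) (opp f, f) (Middlegame f)
  | Prescribes_middlegame_end f k :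
      last_move p = Some (f, k) -> k \in [set #4; opp f] ->
      mark p (opp f, f) = Some Xavier ->
      prescribes p (Middlegame f) (opp f, opp f) (Endgame f)
  | Prescribes_endgame f k :
      k \in active p ->
      prescribes p (Endgame f)
        (k, if mark p (k, f) == None then f else opp f) (Endgame f).

Inductive step : position * phase -> position * phase -> Prop :=
  | Step_Xavier p ph m ph' :
      turn p = Xavier -> prescribes p ph m ph' -> legal p m ->
      step (p, ph) (play_move p m, ph')
  | Step_Olivia p ph m :
      turn p = Olivia -> legal p m ->
      step (p, ph) (play_move p m, ph).

(* A maximal play in which Xavier follows the strategy, [g n] being the
   situation after [n] moves.  The play is constant from the point where no
   step is possible; this includes a possible situation where Xavier is to move
   and the strategy gives no legal move, so that a claim that Xavier wins all
   these plays entails that the strategy never fails to give a legal move. *)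
Definition S_play (g : nat -> position * phase) : Prop :=
  g 0 = (start, Opening 0) /\
  forall n, step (g n) (g n.+1) \/
            (forall s, ~ step (g n) s) /\ g n.+1 = g n.

(** * Properties of the endgame positions with Olivia to move *)

Section Properties.
Variables (p : position) (f : cell).
Local Notation f' := (opp f).

Definition taken (w : player) (m : move) : bool := mark p m == Some w.

(* The active field of the upcoming move is necessarily [x]. *)
Definition plays_in (x : cell) : Prop := active p = [set x].

Definition P1 : Prop := forall i, i \in A f ->
  taken Xavier (i, f) && taken Xavier (i, f') ->
  taken Olivia (f, i) && taken Olivia (f', i).

Definition P2 : Prop := forall i, i \in A f ->
  taken Xavier (i, f) (+) taken Xavier (i, f') ->
  [/\ taken Xavier (i, f),
      taken Olivia (f, i) (+) taken Olivia (f', i)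
    & taken Olivia (f', i) -> plays_in f].

Definition P3 : Prop := forall i, i \in A f ->
  ~~ taken Xavier (i, f) && ~~ taken Xavier (i, f') ->
  ~~ taken Olivia (f, i) && ~~ taken Olivia (f', i).

Definition P4 : Prop :=
  exists2 x, x \in [set f; f'] & plays_in x /\ ~~ full p x.

Definition verifies_P5 (i : cell) : bool :=
  [&& i \in A f, taken Olivia (f', i) & ~~ taken Olivia (f, i)].

Definition P5 : Prop :=
  (plays_in f <-> exists! i, verifies_P5 i) /\
  (plays_in f' <-> forall i, ~~ verifies_P5 i).

Definition P6 : Prop :=
  (forall i j, taken Olivia (i, j) -> i \in [set f; #4; f']) /\
  (forall i, i \in A f ->
     ~~ taken Xavier (f, i) && ~~ taken Xavier (f', i)).

End Properties.

(* Main.v *)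
Require Import Defs.
From mathcomp Require Import all_boot.

(* In each phase the whole board at Olivia's turn is a function of the spots
   that Olivia has taken: [S] in field 4 during the opening, then [a] in field
   [f] and [b] in field [opp f].  In the endgame Xavier owns [(i, f)] iff
   [i] is in [a] or [b], and [(i, opp f)] iff it is in both, while [b :\: a]
   is a singleton if Olivia plays in [f] and empty if she plays in [opp f];
   this is P1-P6.  Olivia can only win the fields 4 and [f], because Xavier has
   completed the line [f], 4, [opp f] of field [opp f] when the endgame starts,
   so she never wins.  If [opp f] is full when she should play there, then [a]
   and [b] are everything and Xavier has won every field other than 4 and [f].
   So Xavier can always follow the strategy until he wins, and the board is
   finite. *)

Set Implicit Arguments.
Unset Strict Implicit.
Unset Printing Implicit Defensive.

(** * Lines of the grid and the symmetry about its centre *)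

Lemma has_line_sub (P Q : pred cell) :
  (forall i, P i -> Q i) -> has_line P -> has_line Q.
Proof. by move=> PQ; apply: sub_has => l; apply: sub_all. Qed.

Lemma opp_eq4 f : f != #4 -> opp f != #4.
Proof. by case: f => [[|[|[|[|[|[|[|[|[|[]]]]]]]]]] ltf]. Qed.

Lemma opp_neq f : f != #4 -> opp f != f.
Proof. by case: f => [[|[|[|[|[|[|[|[|[|[]]]]]]]]]] ltf]. Qed.

Lemma central_line f :
  f != #4 -> has_line [pred j | [|| j == #4, j == f | j == opp f]].
Proof. by case: f => [[|[|[|[|[|[|[|[|[|[]]]]]]]]]] ltf]. Qed.

(** Two opposite sides of the grid avoid the centre and are disjoint, so [f] misses at least one of
    them. *)
Lemma line_avoiding_4 f : f != #4 -> has_line [pred i | (i != #4) && (i != f)].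
Proof. by case: f => [[|[|[|[|[|[|[|[|[|[]]]]]]]]]] ltf]. Qed.

Lemma no_line_in_pair f : ~~ has_line [pred i | (i == #4) || (i == f)].
Proof. by case: f => [[|[|[|[|[|[|[|[|[|[]]]]]]]]]] ltf]. Qed.

Lemma mem_A f i : (i \in A f) = [&& i != #4, i != f & i != opp f].
Proof. by rewrite !inE !negb_or andbA. Qed.

(** * Lines and the status of fields *)

(** The type [position] allows any [status], so this must be maintained. The winner is left open: a
    line of [w] may be completed after the other player has won the field. *)
Definition lines_recorded (p : position) : Prop :=
  forall w i, has_line (fun j => mark p (i, j) == Some w) -> status p i <> None.

(** A line that appears with [m] lies in field [m.1] and belongs to the player who moves, so a field
    still undecided is awarded at once. *)
Lemma lines_recorded_play p m :
  lines_recorded p -> lines_recorded (play_move p m).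
Proof.
move=> recp w i /= line; case: ifP => // no_new.
have [im|im] := eqVneq i m.1; last first.
  apply: (recp w); apply: has_line_sub line => j /=.
  by case: ifP => // /eqP e; rewrite -e eqxx in im.
have [wt|wt] := eqVneq w (turn p); last first.
  apply: (recp w); apply: has_line_sub line => j /=.
  by case: ifP => // _ /eqP [e]; rewrite e eqxx in wt.
by move=> st; move/negP: no_new; apply; rewrite -im st !eqxx -{2}wt.
Qed.

Definition wins_only_in (w : player) (F : pred cell) (p : position) : Prop :=
  forall i, status p i = Some w -> F i.

Lemma wins_only_in_play w F p m :
  wins_only_in w F p -> (turn p = w -> status p m.1 = None -> F m.1) ->
  wins_only_in w F (play_move p m).
Proof.
move=> Fp Fm i /=; case: ifP => [/and3P[/eqP-> /eqP st _] [] /Fm|_ /Fp //].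
exact.
Qed.

Lemma wins_only_in_sub w (F G : pred cell) p :
  (forall i, F i -> G i) -> wins_only_in w F p -> wins_only_in w G p.
Proof. by move=> FG Fp i /Fp /FG. Qed.

Lemma no_win_in_pair w f p :
  wins_only_in w [pred i | (i == #4) || (i == f)] p -> ~~ has_won w p.
Proof.
move=> Fp; apply: contra (no_line_in_pair f); apply: has_line_sub => i /eqP.
exact: Fp.
Qed.

(** * The active field *)

Lemma not_full p i j : mark p (i, j) = None -> ~~ full p i.
Proof. by move=> e; apply/forallPn; exists j; rewrite e. Qed.

Lemma active_forced p i j :
  last_move p = Some (i, j) -> ~~ full p j -> active p = [set j].
Proof. by rewrite /active => -> /negbTE->. Qed.

Lemma active_free p i j :
  last_move p = Some (i, j) -> full p j -> active p = open_fields p.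
Proof. by rewrite /active => -> ->. Qed.

(** * Boards and invariant at Olivia's turn *)

(* [S] is the set of the spots taken by Olivia in field 4. *)
Definition opening_board (S : {set cell}) (m : move) : option player :=
  let: (i, j) := m in
  if i == #4 then
    if j == #4 then Some Xavier else if j \in S then Some Olivia else None
  else if (j == #4) && (i \in S) then Some Xavier else None.

(* After the opening, the whole board is determined by the sets [a] and [b] of
   the spots taken by Olivia in the fields [f] and [opp f]. *)
Definition board (f : cell) (a b : {set cell}) (m : move) : option player :=
  let: (i, j) := m in
  if i == #4 then Some (if j == #4 then Xavier else Olivia)
  else if i == f then
    if j == f then Some Xavier else if j \in a then Some Olivia else None
  else if j == #4 then Some Xavier
  else if i == opp f then
    if j == f then
      if (#4 \in a) || (opp f \in a) then Some Xavier else None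
    else if j == opp f then
      if (#4 \in a) && (opp f \in a) then Some Xavier else None
    else if j \in b then Some Olivia else None
  else if j == f then if (i \in a) || (i \in b) then Some Xavier else None
  else if j == opp f then if (i \in a) && (i \in b) then Some Xavier else None
  else None.

(** The last move determines where Olivia plays. In the middlegame [a] lacks 4 or [opp f], since
    taking both ends that phase. The two endgame constructors differ in her active field; [r] is the
    unique cell that verifies P5. *)
Inductive regular (p : position) : phase -> Prop :=
  | Regular_opening n i S :
      mark p =1 opening_board S -> #4 \notin S -> #|S| = n -> n < 8 ->
      last_move p = Some (i, #4) -> regular p (Opening n.+1)
  | Regular_middlegame f i a :
      f != #4 -> mark p =1 board f a set0 -> f \notin a ->
      ~~ ((#4 \in a) && (opp f \in a)) ->
      last_move p = Some (i, f) -> regular p (Middlegame f)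
  | Regular_endgame_f f i a b r :
      f != #4 -> mark p =1 board f a b -> f \notin a ->
      #4 \in a -> opp f \in a -> b \subset A f -> b :\: a = [set r] ->
      last_move p = Some (i, f) -> regular p (Endgame f)
  | Regular_endgame_opp f i a b :
      f != #4 -> mark p =1 board f a b -> f \notin a ->
      #4 \in a -> opp f \in a -> b \subset A f -> b \subset a ->
      last_move p = Some (i, opp f) -> regular p (Endgame f).

(* The fields that Olivia can have won. *)
Definition lost_fields (ph : phase) : pred cell :=
  match ph with
  | Opening _ => pred1 #4
  | Middlegame f | Endgame f => [pred i | (i == #4) || (i == f)]
  end.

Definition invariant (p : position) (ph : phase) : Prop :=
  [/\ turn p = Olivia, lines_recorded p,
      wins_only_in Olivia (lost_fields ph) p & regular p ph].

(** * Fields won by Xavier in the endgame *)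

Lemma cell_in_A f : f != #4 -> exists i, i \in A f.
Proof.
case: f => [[|[|[|[|[|[|[|[|[|[]]]]]]]]]] ltf] // _;
  first [by exists #1; rewrite mem_A | by exists #0; rewrite mem_A].
Qed.

(** Xavier owns the spots [f], 4 and [opp f] of field [i], which form a line, and Olivia cannot have
    won this field before. *)
Lemma central_fields_won p f a b i :
  f != #4 -> lines_recorded p ->
  wins_only_in Olivia [pred i | (i == #4) || (i == f)] p ->
  mark p =1 board f a b -> #4 \in a -> opp f \in a ->
  i != #4 -> i != f -> i = opp f \/ i \in a /\ i \in b ->
  status p i = Some Xavier.
Proof.
move=> f4 rec lost mk a4 af' i4 iF iab.
have : status p i <> None.
  apply: (rec Xavier); apply: has_line_sub (central_line f4) => j /=.
  rewrite mk /= (negbTE i4) (negbTE iF) a4 af' /=.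
  case/or3P => /eqP->; rewrite ?eqxx ?(negbTE f4) //.
    by case: iab => [->|[-> ->]]; rewrite ?eqxx ?if_same.
  rewrite (negbTE (opp_eq4 f4)) (negbTE (opp_neq f4)).
  by case: iab => [->|[-> ->]]; rewrite ?eqxx ?if_same.
case st : (status p i) => [[]|] // _; move/lost: st => /=.
by rewrite (negbTE i4) (negbTE iF).
Qed.

(** If field [opp f] is full, then [b], hence also [a], contains all of [A f], so Xavier has won
    every field other than 4 and [f]. *)
Lemma won_when_filled p f a b :
  f != #4 -> lines_recorded p ->
  wins_only_in Olivia [pred i | (i == #4) || (i == f)] p ->
  mark p =1 board f a b -> #4 \in a -> opp f \in a -> b \subset a ->
  full p (opp f) -> has_won Xavier p.
Proof.
move=> f4 rec lost mk a4 af' ba /forallP full_f'.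
apply: has_line_sub (line_avoiding_4 f4) => i /andP[i4 iF]; apply/eqP.
apply: (central_fields_won f4 rec lost mk a4 af' i4 iF).
have [->|if'] := eqVneq i (opp f); [by left | right].
suff ib : i \in b by rewrite (subsetP ba).
have := full_f' i; rewrite mk /= (negbTE (opp_eq4 f4)) (negbTE (opp_neq f4)).
by rewrite (negbTE i4) (negbTE iF) (negbTE if') eqxx; case: ifP.
Qed.

(** * Uniqueness and form of Xavier's answer *)

(** The clauses of the strategy exclude each other; only in the endgame could a free choice of the
    active field leave several moves, which the hypothesis rules out. *)
Lemma prescribes_functional p ph m1 ph1 m2 ph2 :
  (forall f, ph = Endgame f -> exists k, active p = [set k]) ->
  prescribes p ph m1 ph1 -> prescribes p ph m2 ph2 -> m1 = m2 /\ ph1 = ph2.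
Proof.
move=> act pr1 pr2.
have disj (g k1 k2 : cell) : k1 \in A g -> k2 \in [set #4; opp g] -> k1 <> k2.
  by rewrite mem_A !inE => /and3P[/negbTE k4 _ /negbTE kf'] + e;
    rewrite -e k4 kf'.
case: pr1 act pr2 => [|n j nlt lm|f lm|f k lm kA|f k lm k4 mk
  |f k lm k4 mk|f k kact] act pr2; inversion pr2; subst => //;
  try (split; congruence);
  try (exfalso; by [apply: (disj f k k0) => //; congruence
                   |apply: (disj f k0 k) => //; congruence]).
have [x actx] := act f erefl; move: kact H0; rewrite actx !inE => /eqP-> /eqP->.
by split.
Qed.

(** Of the conditions of [legal], those saying that nobody has won yet are left to
    [reachable_progress]. *)
Definition answer (q : position) (ph : phase) (m m' : move) (ph' : phase) :=
  let p := play_move q m in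
  [/\ prescribes p ph m' ph',
      forall m1 ph1, prescribes p ph m1 ph1 -> m1 = m' /\ ph1 = ph',
      m'.1 \in active p, mark p m' = None & regular (play_move p m') ph'].

(* Membership in a set has several convertible forms, which [congruence] does
   not identify; [memb] is a normal form for it. *)
Definition memb (a : {set cell}) (j : cell) : bool := j \in a.

Lemma membE (a : {set cell}) (j : cell) : (j \in a) = memb a j.
Proof. by []. Qed.

(** Once [#4] and [opp f] are variables, the equality of two boards at a spot depends only on which
    cells coincide and on set memberships, and all cases are split. *)
Ltac cells :=
  repeat match goal with
    | H : (_ \in _) = _ |- _ => move: H
    | H : _ <> _ |- _ => move: H
  end;
  rewrite ?membE; generalize (#4);
  repeat match goal with |- context [opp ?f] => generalize (opp f) end;
  clear; intros;
  repeat (case: eqP => [?|?] //=; try congruence);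
  repeat match goal with |- context [memb ?a ?j] =>
    let E := fresh in case E : (memb a j) => //=; try congruence
  end.

(** * Answers in the three phases *)

Lemma opening_answer q n m :
  turn q = Olivia -> regular q (Opening n) -> legal q m ->
  m.1 = #4 /\ exists m' ph', answer q (Opening n) m m' ph' /\
    forall i, lost_fields (Opening n) i -> lost_fields ph' i.
Proof.
move=> tq reg /and4P[_ _ + /eqP free].
inversion reg as [n' i S mk S4 cardS n8 lm e1| | |]; subst n.
(* Fewer than eight marks cannot cover the eight outer spots of field 4, so Olivia must play
   there. *)
have [k0 k0S k04] : exists2 k, k \notin S & k != #4.
  have : ~~ ([set~ #4] \subset S).
    by apply/negP => /subset_leq_card; rewrite cardsC1 card_ord cardS leqNgt n8.
  by case/subsetPn => k; rewrite !inE => k4 kS; exists k.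
rewrite (active_forced lm) => [|]; last first.
  by apply: (@not_full _ _ k0); rewrite mk /= (negbTE k04) (negbTE k0S).
rewrite inE => /eqP m4; split=> //; case: m m4 free => _ k /= -> free.
have [k4 kS] : k != #4 /\ k \notin S.
  by move: free; rewrite mk /=; case: eqP; case: (k \in S).
have [n7|n7] := ltnP n'.+1 8.
  exists (k, #4), (Opening n'.+2); split=> //.
  have free' : mark (play_move q (#4, k)) (k, #4) = None.
    rewrite /= xpair_eqE (negbTE k4) mk /= (negbTE k4) (negbTE kS).
    by [].
  split=> //.
  - exact: Prescribes_opening.
  - move=> m1 ph1 pr; apply: (@prescribes_functional _ _ _ _ _ _ _ pr) => //.
    exact: Prescribes_opening.
  - by rewrite (@active_forced _ #4 k) ?inE // (not_full free').
  apply: (@Regular_opening _ _ k (k |: S)) => //; last first.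
  - by rewrite cardsU1 kS cardS.
  - by rewrite !inE negb_or eq_sym k4.
  case=> x y /=; rewrite !xpair_eqE tq mk /= !inE.
  move: k4 kS S4 => /eqP k4 /negbTE kS /negbTE S4; cells.
(* Here [k] is Olivia's eighth mark: it fills field 4, and field [k] is the untouched one. *)
have Sall j : (j \in S) = (j != #4) && (j != k).
  have : k |: S == [set~ #4].
    rewrite eqEcard subUset sub1set !inE k4 cardsC1 card_ord cardsU1 kS cardS n7.
    rewrite andbT; apply/subsetP => x xS; rewrite !inE; apply: contraNneq S4.
    by move=> <-.
  move/eqP/setP/(_ j); rewrite !inE => <-.
  by have [->|_] := eqVneq j k; rewrite /= ?(negbTE kS) ?andbT.
have n'7 : n' = 7 by apply/eqP; rewrite eqn_leq -ltnS n8.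
subst n'; rewrite n'7.
exists (k, k), (Middlegame k); split; last by move=> i0 /= ->.
have free' : mark (play_move q (#4, k)) (k, k) = None.
  by rewrite /= xpair_eqE (negbTE k4) mk /= (negbTE k4).
split=> //.
- exact: Prescribes_middlegame_start.
- move=> m1 ph1 pr; apply: (@prescribes_functional _ _ _ _ _ _ _ pr) => //.
  exact: Prescribes_middlegame_start.
- by rewrite (@active_forced _ #4 k) ?inE // (not_full free').
apply: (@Regular_middlegame _ _ k set0) => //; rewrite ?inE //.
case=> x y /=; rewrite !xpair_eqE tq mk /= !inE !Sall.
move: k4 kS S4 => /eqP k4 /negbTE kS /negbTE S4; cells.
Qed.

(** Every reply before the last one is on a spot [f], which sends Olivia back to field [f]; there 4
    or [opp f] is still free. *)
Lemma middlegame_answer q f m :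
  turn q = Olivia -> regular q (Middlegame f) -> legal q m ->
  m.1 = f /\ exists m' ph', answer q (Middlegame f) m m' ph' /\
    forall i, lost_fields (Middlegame f) i -> lost_fields ph' i.
Proof.
move=> tq reg /and4P[_ _ + /eqP free].
inversion reg as [|f0 i a f4 mk fa few lm e1| |]; subst f0.
have f'4 := opp_eq4 f4; have f'f := opp_neq f4.
have [k0 k0a k0f] : exists2 k, k \notin a & k != f.
  move: few; rewrite negb_and => /orP[h|h]; first by exists #4; rewrite // eq_sym.
  by exists (opp f).
rewrite (active_forced lm) => [|]; last first.
  apply: (@not_full _ _ k0); rewrite mk /= (negbTE f4) eqxx.
  by rewrite (negbTE k0f) (negbTE k0a).
rewrite inE => /eqP mf; split=> //; case: m mf free => _ k /= -> free.
have [kf ka] : k != f /\ k \notin a.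
  by move: free; rewrite mk /= (negbTE f4) eqxx; case: eqP; case: (k \in a).
pose p := play_move q (f, k).
have lmp : last_move p = Some (f, k) by [].
have mkp x y : mark p (x, y) =
    if (x == f) && (y == k) then Some Olivia else board f a set0 (x, y).
  by rewrite /= xpair_eqE tq mk.
have det m1 m2 ph1 ph2 : prescribes p (Middlegame f) m1 ph1 ->
    prescribes p (Middlegame f) m2 ph2 -> m2 = m1 /\ ph2 = ph1.
  by move=> pr1 pr2; apply: prescribes_functional pr2 pr1.
have [kA|kA] := boolP (k \in A f).
  move: (kA); rewrite mem_A => /and3P[k4 _ kf'].
  exists (k, f), (Middlegame f); split=> //.
  have pr : prescribes p (Middlegame f) (k, f) (Middlegame f).
    exact: Prescribes_middlegame_A.
  have free' : mark p (k, f) = None.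
    by rewrite mkp /= !inE (negbTE k4) (negbTE kf) (negbTE kf') (negbTE ka)
      (negbTE f4) eqxx.
  split=> //.
  - exact: (fun m1 ph1 => det _ m1 _ ph1 pr).
  - by rewrite (active_forced lmp) ?inE // (not_full free').
  apply: (@Regular_middlegame _ _ k (k |: a)) => //.
  - case=> x y; rewrite /= mk /= !inE !xpair_eqE tq /=.
    move: f4 f'4 f'f kf k4 kf' fa ka.
    move=> /eqP ? /eqP ? /eqP ? /eqP ? /eqP ? /eqP ? /negbTE ? /negbTE ?.
    cells.
  - by rewrite !inE negb_or eq_sym kf.
  - by rewrite !inE ![_ == k]eq_sym (negbTE k4) (negbTE kf').
have k4f' : k \in [set #4; opp f].
  by move: kA; rewrite mem_A kf !inE /= negb_and !negbK.
(* If [k] is [opp f] this field is forced; if [k] is 4, field 4 is full and Xavier chooses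
   freely. *)
have f'open : mark p (opp f, f) = None \/ mark p (opp f, opp f) = None ->
    opp f \in active p.
  move=> freef'; have f'nf : ~~ full p (opp f).
    by case: freef' => /not_full.
  move: k4f'; rewrite !inE => /orP[]/eqP ek; last first.
    by rewrite (active_forced lmp) ek ?inE.
  rewrite (active_free lmp) ?inE // ek; apply/forallP => y.
  by rewrite mkp [#4 == f]eq_sym (negbTE f4).
have mkp' : mark p (opp f, f) =
    if (#4 \in a) || (opp f \in a) then Some Xavier else None.
  by rewrite mkp /= (negbTE f'f) (negbTE f'4) !eqxx (negbTE f4).
(* Xavier owns [(opp f, f)] exactly when Olivia has already taken 4 or [opp f] in field [f]. *)
have [once|first] := boolP ((#4 \in a) || (opp f \in a)); last first.
  exists (opp f, f), (Middlegame f); split=> //.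
  have free' : mark p (opp f, f) = None by rewrite mkp' (negbTE first).
  have pr : prescribes p (Middlegame f) (opp f, f) (Middlegame f).
    by apply: Prescribes_middlegame_once lmp k4f' _; rewrite free'.
  split=> //.
  - exact: (fun m1 ph1 => det _ m1 _ ph1 pr).
  - by apply: f'open; left.
  apply: (@Regular_middlegame _ _ (opp f) (k |: a)) => //.
  - case=> x y; rewrite /= mk /= !inE !xpair_eqE tq /=.
    move: f4 f'4 f'f kf fa ka first k4f'; rewrite negb_or !inE.
    move=> /eqP ? /eqP ? /eqP ? /eqP ? /negbTE ? /negbTE ? /andP[].
    move=> /negbTE ? /negbTE ? /orP[] /eqP ?; subst k; cells.
  - by rewrite !inE negb_or eq_sym kf.
  - move: first; rewrite negb_or !inE => /andP[/negbTE-> /negbTE->].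
    rewrite !orbF; apply/negP => /andP[/eqP e4 /eqP e].
    by rewrite e -e4 eqxx in f'4.
exists (opp f, opp f), (Endgame f); split=> //.
have pr : prescribes p (Middlegame f) (opp f, opp f) (Endgame f).
  by apply: Prescribes_middlegame_end lmp k4f' _; rewrite mkp' once.
have free' : mark p (opp f, opp f) = None.
  by rewrite mkp /= !eqxx (negbTE f'f) (negbTE f'4) (negbTE few).
(* The spot [k] was free, so it is the one of 4 and [opp f] that was missing from [a]. *)
have both : (#4 \in k |: a) && (opp f \in k |: a).
  move: once k4f'; rewrite !inE ![_ == k]eq_sym.
  by case/orP => h /orP[] /eqP e; move: ka; rewrite e ?h ?eqxx ?orbT.
have [both4 bothf'] := andP both.
split=> //.
- exact: (fun m1 ph1 => det _ m1 _ ph1 pr).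
- by apply: f'open; right.
apply: (@Regular_endgame_opp _ _ (opp f) (k |: a) set0) => //.
- case=> x y; rewrite /= mk /= both once !inE !xpair_eqE tq /=.
  move: f4 f'4 f'f kf fa ka k4f' few; rewrite !inE.
  move=> /eqP ? /eqP ? /eqP ? /eqP ? /negbTE ? /negbTE ? + /negbTE few.
  by rewrite few => /orP[] /eqP ?; subst k; cells.
- by rewrite !inE negb_or eq_sym kf.
- exact: sub0set.
- exact: sub0set.
Qed.

Lemma endgame_not_full p f a b :
  f != #4 -> lines_recorded p ->
  wins_only_in Olivia [pred i | (i == #4) || (i == f)] p ->
  mark p =1 board f a b -> #4 \in a -> opp f \in a -> b \subset a ->
  ~~ has_won Xavier p -> ~~ full p (opp f).
Proof.
move=> f4 rec lost mk a4 af' ba; apply: contra.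
exact: (won_when_filled f4 rec lost mk).
Qed.

(** The free spot [(k, j)] shows that field [k] is not full; it is then the only active field, as
    uniqueness of the answer requires. *)
Lemma endgame_answerI q f x k j :
  let p := play_move q (x, k) in
  mark p (k, j) = None -> j = (if mark p (k, f) == None then f else opp f) ->
  regular (play_move p (k, j)) (Endgame f) ->
  answer q (Endgame f) (x, k) (k, j) (Endgame f).
Proof.
move=> p free jE reg.
have act : active p = [set k] by apply: (@active_forced _ x); rewrite ?(not_full free).
have pr : prescribes p (Endgame f) (k, j) (Endgame f).
  by rewrite jE; apply: Prescribes_endgame; rewrite act inE.
split=> //; last by rewrite act inE.
move=> m1 ph1 pr1; apply: (prescribes_functional _ pr1 pr) => _ _.
by exists k.
Qed.

(** Olivia's mark [k] is the first or the second of the pair [(f, k)], [(opp f, k)]. After a first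
    mark Xavier takes [(k, f)] and sends her to [f]; after a second one he takes [(k, opp f)] and
    sends her to [opp f]. *)
Lemma endgame_answer q f m :
  turn q = Olivia -> lines_recorded q ->
  wins_only_in Olivia (lost_fields (Endgame f)) q ->
  regular q (Endgame f) -> legal q m ->
  (status q m.1 = None -> m.1 = f) /\
  exists m', answer q (Endgame f) m m' (Endgame f).
Proof.
move=> tq rec lost reg /and4P[nowin _ + /eqP free].
inversion reg as [| |f0 i a b r f4 mk fa a4 af' bA ba lm e1
                  |f0 i a b f4 mk fa a4 af' bA ba lm e1]; subst f0.
- have f'4 := opp_eq4 f4; have f'f := opp_neq f4.
  have mem_r j : (j \in b) && (j \notin a) = (j == r).
    by move/setP/(_ j): ba; rewrite !inE andbC.
  have /andP[rb ra] : (r \in b) && (r \notin a) by rewrite mem_r.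
  have := subsetP bA _ rb; rewrite mem_A => /and3P[r4 rf rf'].
  rewrite (active_forced lm) => [|]; last first.
    by apply: (@not_full _ _ r); rewrite mk /= (negbTE f4) eqxx (negbTE rf) (negbTE ra).
  rewrite inE => /eqP mf; split=> //; case: m mf free => _ k /= -> free.
  have [kf ka] : k != f /\ k \notin a.
    by move: free; rewrite mk /= (negbTE f4) eqxx; case: eqP; case: (k \in a).
  have k4 : k != #4 by apply: contraNneq ka => ->.
  have kf' : k != opp f by apply: contraNneq ka => ->.
  have mkp x y : mark (play_move q (f, k)) (x, y) =
      if (x == f) && (y == k) then Some Olivia else board f a b (x, y).
    by rewrite /= xpair_eqE tq mk.
  have mkf : mark (play_move q (f, k)) (k, f) =
      if k \in b then Some Xavier else None.
    by rewrite mkp /= !eqxx (negbTE kf) (negbTE k4) (negbTE kf') (negbTE ka)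
      (negbTE f4).
  have mkf' : mark (play_move q (f, k)) (k, opp f) = None.
    by rewrite mkp /= !eqxx (negbTE kf) (negbTE k4) (negbTE kf') (negbTE ka)
      (negbTE f'4) (negbTE f'f).
  (* If [k] is in [b] then [k = r], and adding it to [a] makes [b] a subset of [a]; otherwise [r]
     remains the exception. *)
  have [kb|kb] := boolP (k \in b).
  + exists (k, opp f); apply: endgame_answerI => //; first by rewrite mkf kb.
    apply: (@Regular_endgame_opp _ _ k (k |: a) b) => //.
    * case=> x y; rewrite /= mk /= !inE !xpair_eqE tq /=.
      move: f4 f'4 f'f kf k4 kf' fa ka (kb : (k \in b) = true) a4 af'.
      move=> /eqP ? /eqP ? /eqP ? /eqP ? /eqP ? /eqP ? /negbTE ? /negbTE ?.
      by move=> ? a4 af'; rewrite ?a4 ?af'; cells.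
    * by rewrite !inE negb_or eq_sym kf.
    * by rewrite !inE a4 orbT.
    * by rewrite !inE af' orbT.
    * apply/subsetP => j jb; rewrite !inE; case ja : (j \in a); rewrite ?orbT //.
      by rewrite orbF; move: (mem_r j) (mem_r k); rewrite jb ja kb ka /=
        => /esym/eqP-> /esym/eqP->.
  + exists (k, f); apply: endgame_answerI => //;
      [by rewrite mkf (negbTE kb) | by rewrite mkf (negbTE kb) |].
    apply: (@Regular_endgame_f _ _ k (k |: a) b r) => //.
    * case=> x y; rewrite /= mk /= !inE !xpair_eqE tq /=.
      move: f4 f'4 f'f kf k4 kf' fa ka kb a4 af'.
      move=> /eqP ? /eqP ? /eqP ? /eqP ? /eqP ? /eqP ? /negbTE ? /negbTE ?.
      by move=> /negbTE ? a4 af'; rewrite ?a4 ?af'; cells.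
    * by rewrite !inE negb_or eq_sym kf.
    * by rewrite !inE a4 orbT.
    * by rewrite !inE af' orbT.
    * apply/setP => j; rewrite !inE -mem_r negb_or andbC andbCA.
      by have [->|] := eqVneq j k; rewrite ?(negbTE kb).
- have f'4 := opp_eq4 f4; have f'f := opp_neq f4.
  rewrite (active_forced lm) => [|]; last first.
    exact: (endgame_not_full f4 rec lost mk).
  rewrite inE => /eqP mf; case: m mf free => _ k /= -> free; split.
    (* Field [opp f] is already Xavier's, so Olivia gains no field by playing there. *)
    by rewrite (central_fields_won f4 rec lost mk) //; left.
  have [[k4 kf] [kf' kb]] :
      (k != #4 /\ k != f) /\ (k != opp f /\ k \notin b).
    move: free; rewrite mk /= (negbTE f'4) (negbTE f'f) eqxx a4 af' /=.
    by do 3 case: eqP => //; case: (k \in b).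
  have kA : k \in A f by rewrite mem_A k4 kf kf'.
  have bA' : k |: b \subset A f by rewrite subUset sub1set kA.
  have mkp x y : mark (play_move q (opp f, k)) (x, y) =
      if (x == opp f) && (y == k) then Some Olivia else board f a b (x, y).
    by rewrite /= xpair_eqE tq mk.
  have mkf : mark (play_move q (opp f, k)) (k, f) =
      if k \in a then Some Xavier else None.
    by rewrite mkp /= !eqxx (negbTE kf) (negbTE k4) (negbTE kf') (negbTE kb)
      (negbTE f4) orbF.
  have mkf' : mark (play_move q (opp f, k)) (k, opp f) = None.
    by rewrite mkp /= !eqxx (negbTE kf) (negbTE k4) (negbTE kf') (negbTE kb)
      (negbTE f'4) (negbTE f'f) andbF.
  (* If [k] is not in [a], it becomes the single element of [b :\: a]. *)
  have [ka|ka] := boolP (k \in a).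
  + exists (k, opp f); apply: endgame_answerI => //; first by rewrite mkf ka.
    apply: (@Regular_endgame_opp _ _ k a (k |: b)) => //.
    * case=> x y; rewrite /= mk /= !inE !xpair_eqE tq /=.
      move: f4 f'4 f'f kf k4 kf' fa kb (ka : (k \in a) = true) a4 af'.
      move=> /eqP ? /eqP ? /eqP ? /eqP ? /eqP ? /eqP ? /negbTE ? /negbTE ?.
      by move=> ? a4 af'; rewrite ?a4 ?af'; cells.
    * by rewrite subUset sub1set ka.
  + exists (k, f); apply: endgame_answerI => //;
      [by rewrite mkf (negbTE ka) | by rewrite mkf (negbTE ka) |].
    apply: (@Regular_endgame_f _ _ k a (k |: b) k) => //.
    * case=> x y; rewrite /= mk /= !inE !xpair_eqE tq /=.
      move: f4 f'4 f'f kf k4 kf' fa ka kb a4 af'.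
      move=> /eqP ? /eqP ? /eqP ? /eqP ? /eqP ? /eqP ? /negbTE ? /negbTE ?.
      by move=> /negbTE ? a4 af'; rewrite ?a4 ?af'; cells.
    * apply/setP => j; rewrite !inE.
      have [->|] := eqVneq j k; first by rewrite ka.
      by case jb : (j \in b); rewrite ?andbF // (subsetP ba).
Qed.

(** * The properties P1-P6 *)

Lemma endgame_properties p f :
  invariant p (Endgame f) -> ~~ has_won Xavier p ->
  P1 p f /\ P2 p f /\ P3 p f /\ P4 p f /\ P5 p f /\ P6 p f.
Proof.
case=> _ rec lost reg nowin.
(* Both endgame cases are merged, with [x] the field where Olivia plays. *)
have [a [b [x [[f4 mk bA] [nfull act] turns]]]] : exists a b x,
    [/\ [/\ f != #4, mark p =1 board f a b & b \subset A f],
        ~~ full p x /\ active p = [set x]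
      & x = f /\ (exists r, b :\: a = [set r]) \/ x = opp f /\ b \subset a].
  inversion reg as [| |f0 i a b r f4 mk fa a4 af' bA ba lm
                    |f0 i a b f4 mk fa a4 af' bA ba lm]; subst f0; exists a, b.
    have nfull : ~~ full p f.
      have /setDP[rb ra] : r \in b :\: a by rewrite ba inE.
      have := subsetP bA _ rb; rewrite mem_A => /and3P[_ rf _].
      by apply: (@not_full _ _ r); rewrite mk /= (negbTE f4) eqxx
        (negbTE rf) (negbTE ra).
    exists f; split=> //; first by split=> //; apply: active_forced lm nfull.
    by left; split=> //; exists r.
  have nfull := endgame_not_full f4 rec lost mk a4 af' ba nowin.
  exists (opp f); split=> //; first by split=> //; apply: active_forced lm nfull.
  by right.
have f'4 := opp_eq4 f4; have f'f := opp_neq f4.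
have markA (i : cell) : i \in A f ->
    [/\ taken p Xavier (i, f) = (i \in a) || (i \in b),
        taken p Xavier (i, opp f) = (i \in a) && (i \in b),
        taken p Olivia (f, i) = (i \in a), taken p Olivia (opp f, i) = (i \in b)
      & ~~ taken p Xavier (f, i) && ~~ taken p Xavier (opp f, i)].
  rewrite mem_A /taken !mk /= => /and3P[/negbTE i4 /negbTE iF /negbTE iF'].
  rewrite i4 iF iF' !eqxx (negbTE f4) (negbTE f'4) (negbTE f'f).
  by case: (i \in a); case: (i \in b).
(* P5 thus says that Olivia plays in [f] or [opp f] according to whether [b :\: a] is a singleton or
   empty. *)
have v5 i : verifies_P5 p f i = (i \in b :\: a).
  rewrite /verifies_P5 in_setD; case iA : (i \in A f) => /=.
    by have [_ _ -> -> _] := markA i iA; rewrite andbC.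
  case ib : (i \in b); last by rewrite andbF.
  by rewrite (subsetP bA) in iA.
have plays y : plays_in p y <-> x = y.
  by rewrite /plays_in act; split=> [/set1_inj|->].
refine (conj _ (conj _ (conj _ (conj _ (conj _ _))))).
- by move=> i /markA[-> -> -> -> _]; case: (i \in a); case: (i \in b).
- move=> i /markA[e1 e2 e3 e4 _]; rewrite e1 e2 => one; split.
  + by move: one; case: (i \in a); case: (i \in b).
  + by rewrite e3 e4; move: one; case: (i \in a); case: (i \in b).
  + rewrite e4 => ib; apply/plays; case: turns => [[]//|[_ /subsetP/(_ i ib) ia]].
    by rewrite ia ib in one.
- by move=> i /markA[-> -> -> -> _]; case: (i \in a); case: (i \in b).
- exists x; last by split.
  by case: turns => [[-> _]|[-> _]]; rewrite !inE eqxx ?orbT.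
- case: turns => [[xf [r ba]]|[xf' ba]].
    split; split.
    + by move=> _; exists r; split=> [|j]; rewrite v5 ba inE // => /eqP.
    + by move=> _; apply/plays.
    + by move/plays; rewrite xf => e; rewrite -e eqxx in f'f.
    + by move/(_ r); rewrite v5 ba inE eqxx.
  have ba0 i : verifies_P5 p f i = false.
    by rewrite v5 inE; case ib : (i \in b); rewrite ?andbF // (subsetP ba).
  split; split.
  + by move/plays; rewrite xf' => e; rewrite e eqxx in f'f.
  + by case=> r []; rewrite ba0.
  + by move=> _ i; rewrite ba0.
  + by move=> _; apply/plays.
- split=> [i j|i /markA[]//].
  rewrite /taken mk /= !inE.
  by case: (i == #4); case: (i == f); case: (i == opp f) => //=; do ?case: ifP.
Qed.

(** * Available moves and the absence of a win for Olivia *)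

Lemma free_spot p ph : regular p ph -> exists m, mark p m = None.
Proof.
case=> [n i S mk _ _ _ _|f i a f4 mk _ _ _|f i a b r f4 mk _ _ _ _ _ _
  |f i a b f4 mk _ _ _ _ _ _]; first by exists (#0, #0); rewrite mk.
all: have [j jA] := cell_in_A f4; move: jA; rewrite mem_A => /and3P[j4 jf jf'].
(* In a field [j] of [A f] only the spots 4, [f] and [opp f] are ever used. *)
all: exists (j, j); rewrite mk /= (negbTE j4) (negbTE jf) (negbTE jf').
all: by [].
Qed.

Lemma free_active_spot p :
  (exists m, mark p m = None) -> exists2 m, m.1 \in active p & mark p m = None.
Proof.
case=> [[x y] free]; have xopen := not_full free.
case lm : (last_move p) => [[i j]|]; last first.
  by exists (x, y); rewrite // /active lm inE.
have [fullj|nfullj] := boolP (full p j).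
  by exists (x, y); rewrite // (active_free lm) ?inE.
have /forallPn[k /negPn/eqP free'] := nfullj.
by exists (j, k); rewrite // (active_forced lm) ?inE.
Qed.

Lemma lost_fields_pair ph :
  exists f, forall i, lost_fields ph i -> (i == #4) || (i == f).
Proof.
by case: ph => [n|f|f]; [exists #4 => i /eqP->| exists f | exists f].
Qed.

Lemma no_win_of_lost_fields ph p :
  wins_only_in Olivia (lost_fields ph) p -> ~~ has_won Olivia p.
Proof.
have [f sub] := lost_fields_pair ph; move=> lost.
by apply: (@no_win_in_pair _ f); apply: wins_only_in_sub lost.
Qed.

(** * Preservation of the invariant and progress *)

Lemma invariant_answer q ph m :
  invariant q ph -> legal q m ->
  wins_only_in Olivia (lost_fields ph) (play_move q m) /\
  exists m' ph', answer q ph m m' ph' /\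
    invariant (play_move (play_move q m) m') ph'.
Proof.
case=> tq rec lost reg leg.
suff [lostm [m' [ph' [ans sub]]]] : (status q m.1 = None -> lost_fields ph m.1)
    /\ exists m' ph', answer q ph m m' ph' /\
         forall i, lost_fields ph i -> lost_fields ph' i.
  have lost' : wins_only_in Olivia (lost_fields ph) (play_move q m).
    by apply: wins_only_in_play.
  split=> //; exists m', ph'; split=> //; split.
  - by rewrite /= tq.
  - by do 2 apply: lines_recorded_play.
  - apply: wins_only_in_play; last by rewrite /= tq.
    exact: wins_only_in_sub lost'.
  - by case: ans.
case: ph lost reg => [n|f|f] lost reg.
- by have [-> ex] := opening_answer tq reg leg.
- by have [-> ex] := middlegame_answer tq reg leg; split=> // _ /=; rewrite eqxx orbT.
- have [mf [m' ans]] := endgame_answer tq rec lost reg leg.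
  split; last by exists m', (Endgame f).
  by move=> /mf-> /=; rewrite eqxx orbT.
Qed.

(** The invariant speaks of Olivia's turns only; after the first move, a position with Xavier to
    move is described as one legal move past such a turn, in the same phase. *)
Definition reachable (p : position) (ph : phase) : Prop :=
  [\/ p = start /\ ph = Opening 0, invariant p ph
    | exists q m, [/\ invariant q ph, legal q m & p = play_move q m]].

Lemma invariant_first : invariant (play_move start (#4, #4)) (Opening 1).
Proof.
split=> //; first exact: lines_recorded_play.
  by apply: wins_only_in_play.
apply: (@Regular_opening _ 0 #4 set0); rewrite ?inE ?cards0 //.
by case=> x y /=; rewrite !inE andbF xpair_eqE; do 2 case: eqP.
Qed.

Lemma reachable_step p ph p' ph' :
  reachable p ph -> step (p, ph) (p', ph') -> reachable p' ph'.
Proof.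
move=> reach st.
inversion st as [p0 ph0 m ph0' tX pr leg e1 e2|p0 ph0 m tO leg e1 e2]; subst.
- case: reach => [[ep eph]|[tO]|[q [m0 [inv leg0 ep]]]].
  + subst; inversion pr; subst => //; apply: Or32; exact: invariant_first.
  + by rewrite tX in tO.
  + have [_ [m' [ph'' [[_ uniq _ _ _] inv']]]] := invariant_answer inv leg0.
    by subst; have [-> ->] := uniq _ _ pr; apply: Or32.
- case: reach => [[ep eph]|inv|[q [m0 [[tq _ _ _] leg0 ep]]]].
  + by rewrite ep in tO.
  + by apply: Or33; exists p, m.
  + by rewrite ep /= tq in tO.
Qed.

(** This excludes both a draw and a failure of the strategy: Olivia always has a free spot to play,
    and Xavier's answer is legal. *)
Lemma reachable_progress p ph :
  reachable p ph -> ~~ has_won Xavier p -> exists s, step (p, ph) s.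
Proof.
move=> reach nowin; case: reach nowin => [[-> ->] _|inv nowin|].
- exists (play_move start (#4, #4), Opening 1); apply: Step_Xavier => //.
    exact: Prescribes_first.
  by rewrite /legal /= /active /= !inE andbT; apply/forallPn; exists #0.
- have [tO _ lost reg] := inv.
  have [m mact free] := free_active_spot (free_spot reg).
  exists (play_move p m, ph); apply: Step_Olivia => //.
  by rewrite /legal nowin (no_win_of_lost_fields lost) mact free eqxx.
- move=> [q [m [inv leg ->]]] nowin.
  have [lost [m' [ph' [[pr _ mact free _] _]]]] := invariant_answer inv leg.
  have [tq _ _ _] := inv.
  exists (play_move (play_move q m) m', ph'); apply: Step_Xavier => //=.
    by rewrite tq.
  by rewrite /legal nowin (no_win_of_lost_fields lost) mact free eqxx.
Qed.

(** * Termination and conclusion *)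

Definition free_spots (p : position) : {set move} :=
  [set m | mark p m == None].

Lemma free_spots_step p ph p' ph' :
  step (p, ph) (p', ph') -> #|free_spots p'| < #|free_spots p|.
Proof.
have dec m : legal p m -> #|free_spots (play_move p m)| < #|free_spots p|.
  case/and4P=> _ _ _ free; apply: proper_card; apply/properP; split.
    by apply/subsetP => x; rewrite !inE /=; case: (x == m).
  by exists m; rewrite !inE //= eqxx.
by move=> st; inversion st; subst; apply: dec.
Qed.

Lemma S_play_reachable g n : S_play g -> reachable (g n).1 (g n).2.
Proof.
case=> g0 gS; elim: n => [|n IHn]; first by rewrite g0; apply: Or31.
have [st|[_ ->//]] := gS n; apply: reachable_step IHn _.
by rewrite -!surjective_pairing.
Qed.

Lemma S_play_won g : S_play g -> exists n, has_won Xavier (g n).1.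
Proof.
(* Induction on a bound for the number of free spots, which drops at each step; as long as Xavier
   has not won, the play cannot be stationary. *)
move=> play; suff won k n : #|free_spots (g n).1| < k ->
    exists n', has_won Xavier (g n').1 by apply: (won _ 0 (ltnSn _)).
elim: k n => // k IHk n; rewrite ltnS => le_k.
have [|nowin] := boolP (has_won Xavier (g n).1); first by exists n.
have [s st] := reachable_progress (S_play_reachable n play) nowin.
have [_ gS] := play; have [st'|[stuck _]] := gS n; last first.
  by case: (stuck s); rewrite (surjective_pairing (g n)).
apply: (IHk n.+1); apply: leq_trans le_k.
by apply: (@free_spots_step _ (g n).2 _ (g n.+1).2); rewrite -!surjective_pairing.
Qed.

Theorem corollary1 :
  (forall (g : nat -> position * phase) (n : nat) (p : position) (f : cell),
     S_play g -> g n = (p, Endgame f) -> turn p = Olivia ->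
     ~~ has_won Xavier p ->
     P1 p f /\ P2 p f /\ P3 p f /\ P4 p f /\ P5 p f /\ P6 p f) /\
  (forall g : nat -> position * phase,
     S_play g -> exists n : nat, has_won Xavier (g n).1).
Proof.
split=> [g n p f play gn tO nowin|]; last exact: S_play_won.
apply: endgame_properties nowin.
have := S_play_reachable n play; rewrite gn /=.
case=> [[_]|//|[q [m [[tq _ _ _] _ ep]]]] //.
by rewrite ep /= tq in tO.
Qed.
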